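(* Let $X$ be a normed space, let $\varphi: X\to(-\infty,\infty]$ and $f:X\to(-\infty,\infty]$ be extended-real-valued functions with $\varphi(0)=0$, and let $T_\varphi^f(x):=\inf\{\varphi(y-x)+f(y)\mid y\in X\}$ for $x\in X$. Let $\bar x\in S_0:=\{x\in \mathrm{dom}\,T_\varphi^f\mid T_\varphi^f(x)=f(x)\}$. Suppose that $\varphi$ is coercive on $X$ with constant $m>0$ and that $f$ satisfies a center-Lipschitz condition on $D:=\mathrm{dom}\,f$ at $\bar x$ with constant $\ell$, where $0\le \ell<m$. Then for every $\epsilon\ge 0$ and every $x^*\in \widehat\partial_\epsilon f(\bar x)\cap[-\widehat\partial_\epsilon\varphi(0)]$ one has $$x^*\in\widehat\partial_{\alpha\epsilon}T_\varphi^f(\bar x),\quad\text{where }\alpha:=2(\|x^*\|+m)(m-\ell)^{-1}+1.$$ Moreover, $$\widehat\partial T_\varphi^f(\bar x)=\widehat\partial f(\bar x)\cap[-\widehat\partial\varphi(0)].$$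
   Context: $X$ is a (real) normed space, $X^*$ its topological dual with the dual norm, and $\langle\cdot,\cdot\rangle$ the pairing between them. For $g:X\to[-\infty,\infty]$, $\mathrm{dom}\,g:=\{x\in X\mid |g(x)|<\infty\}$. For $\bar x\in\mathrm{dom}\,g$ and $\epsilon\ge0$, the $\epsilon$-Fréchet subdifferential is $$\widehat\partial_\epsilon g(\bar x):=\Big\{x^*\in X^*\;\Big|\;\liminf_{x\to\bar x}\frac{g(x)-g(\bar x)-\langle x^*,x-\bar x\rangle}{\|x-\bar x\|}\ge-\epsilon\Big\},$$ where the liminf is over $x\neq\bar x$; the Fréchet subdifferential is $\widehat\partial g(\bar x):=\widehat\partial_0 g(\bar x)$. For a set $A\subset X^*$, $-A:=\{-a\mid a\in A\}$. A function $g:X\to(-\infty,\infty]$ is coercive with constant $m>0$ on $X$ if $m\|x\|\le g(x)$ for all $x\in X$. A function $g$ satisfies a center-Lipschitz condition on a set $D\subset X$ at $\bar x\in D$ with constant $\ell\ge0$ if $|g(x)-g(\bar x)|\le\ell\|x-\bar x\|$ for all $x\in D$. *)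

(* Defs.v *)
From HB Require Import structures.
From mathcomp Require Import all_boot all_order all_algebra.
From mathcomp Require Import all_classical all_reals all_analysis.
Import Order.TTheory GRing.Theory Num.Theory.
Import numFieldNormedType.Exports.

Set Implicit Arguments.
Unset Strict Implicit.
Unset Printing Implicit Defensive.

Local Open Scope classical_set_scope.
Local Open Scope ring_scope.

Definition dual_pred (R : realType) (X : normedModType R) : {pred X -> R^o} :=
  fun h => `[< linear h /\ continuous h >].
Arguments dual_pred {R} X.

Lemma dual_predP (R : realType) (X : normedModType R) (h : X -> R^o) :
  reflect (linear h /\ continuous h) (h \in dual_pred X).
Proof. exact: asboolP. Qed.

Lemma dual_pred_submod_closed (R : realType) (X : normedModType R) :
  submod_closed (dual_pred X).
Proof.
split=> [|a u v /dual_predP[ul uc] /dual_predP[vl vc]]; apply/dual_predP; split.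
- by move=> b x y; rewrite scaler0 add0r.
- by move=> x; exact: cvg_cst.
- move=> b x y; rewrite !fctE ul vl !scalerDr !scalerA [b * a]mulrC -!addrA.
  by congr (_ + _); rewrite addrCA.
- move=> x; apply: cvgD; last exact: vc.
  by apply: cvgZr; exact: uc.
Qed.

HB.instance Definition _ (R : realType) (X : normedModType R) :=
  GRing.isSubmodClosed.Build R (X -> R^o) (dual_pred X)
    (dual_pred_submod_closed X).

(* The lmodType structure inherited from X -> R^o gives sense to - xs in the
   dual. *)
Record dual_space (R : realType) (X : normedModType R) := Dual {
  dual_fun :> X -> R^o ;
  dual_funP : dual_fun \in dual_pred X }.

HB.instance Definition _ (R : realType) (X : normedModType R) :=
  [isSub for @dual_fun R X].
HB.instance Definition _ (R : realType) (X : normedModType R) :=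
  [Choice of dual_space X by <:].
HB.instance Definition _ (R : realType) (X : normedModType R) :=
  [SubChoice_isSubLmodule of dual_space X by <:].

(* The set is nonempty (x = 0) and bounded (xs is continuous), so sup is the
   true supremum. *)
Definition dual_norm (R : realType) (X : normedModType R) (xs : dual_space X) : R :=
  sup [set `|xs x| | x in [set x : X | `|x| <= 1]].

(* Finiteness, unlike the usual convention g x < +oo, also excludes -oo. *)
Definition dom (R : realType) (X : normedModType R) (g : X -> \bar R) : set X :=
  [set x | g x \is a fin_num].

(* Only meaningful for xb in dom g, where no oo - oo arises in the numerator. *)
Definition frechet_subdiff (R : realType) (X : normedModType R)
    (eps : R) (g : X -> \bar R) (xb : X) : set (dual_space X) :=
  [set xs : dual_space X | ((- eps)%:E <=
    limf_einf (fun x => (g x - g xb - (xs (x - xb))%:E) * (`|x - xb|^-1)%:E)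
      xb^')%E].

Definition coercive (R : realType) (X : normedModType R)
    (m : R) (g : X -> \bar R) : Prop :=
  forall x, ((m * `|x|)%:E <= g x)%E.

Definition center_lipschitz (R : realType) (X : normedModType R)
    (l : R) (g : X -> \bar R) (D : set X) (xb : X) : Prop :=
  forall x, D x -> (`|g x - g xb| <= (l * `|x - xb|)%:E)%E.

(* T_phi^f; both summands are meant to be > -oo. *)
Definition inf_conv (R : realType) (X : normedModType R)
    (phi f : X -> \bar R) (x : X) : \bar R :=
  ereal_inf [set (phi (y - x)%R + f y)%E | y in [set: X]].

Definition S0 (R : realType) (X : normedModType R)
    (phi f : X -> \bar R) : set X :=
  [set x | dom (inf_conv phi f) x /\ inf_conv phi f x = f x].

(* Main.v *)
Require Import Defs.
From HB Require Import structures.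
From mathcomp Require Import all_boot all_order all_algebra.
From mathcomp Require Import all_classical all_reals all_analysis.
From mathcomp Require Import lra.

Set Implicit Arguments.
Unset Strict Implicit.
Unset Printing Implicit Defensive.

Import Order.TTheory GRing.Theory Num.Theory.
Import numFieldNormedType.Exports.
Local Open Scope classical_set_scope.
Local Open Scope ring_scope.

(** Write T for the infimal convolution. Since T(x) <= phi(y - x) + f(y) for every y, choosing y = x
    or y = xb bounds T by f or by a translate of phi, with equality at [xb]. A subgradient estimate
    for T thus passes to f, and with opposite sign to phi ([frechet_subdiff_inf_conv_sub]).
    Conversely, [frechet_subdiff_inf_conv] bounds phi(y - x) + f(y) from below uniformly in y. For y
    close to x relative to |x - xb|, the two estimates add up, the terms in y cancelling in xs(y -
    xb) - xs(y - x) = xs(x - xb). For distant y, the growth (m - l)|y - x| wins. At eps = 0 the loss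
    factor alpha disappears, so the two inclusions give equality. *)

Lemma dual_fun_linear (R : realType) (X : normedModType R) (xs : dual_space X) :
  linear (dual_fun xs).
Proof. by have /dual_predP[] := dual_funP xs. Qed.

HB.instance Definition _ (R : realType) (X : normedModType R)
    (xs : dual_space X) :=
  GRing.isLinear.Build R X R^o *:%R (dual_fun xs) (dual_fun_linear xs).

Lemma dual_bounded (R : realType) (X : normedModType R) (xs : dual_space X) :
  has_ubound [set `|xs x| | x in [set x : X | `|x| <= 1]].
Proof.
have /linear_boundedP[M [_ Mxs]] : bounded_near (dual_fun xs) (nbhs 0).
  apply: continuous_linear_bounded.
  by have /dual_predP[_ /(_ 0)] := dual_funP xs.
have M1 : M < `|M| + 1 by rewrite (le_lt_trans (ler_norm M))// ltrDl.
exists (`|M| + 1) => _ [y /= y1 <-]; apply: (le_trans (Mxs _ M1 y)).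
by rewrite ler_piMr// addr_ge0.
Qed.

Lemma dual_norm_ge0 (R : realType) (X : normedModType R) (xs : dual_space X) :
  0 <= dual_norm xs.
Proof.
apply: (ub_le_sup (dual_bounded xs)); exists 0 => /=; first by rewrite normr0.
by rewrite linear0 normr0.
Qed.

Lemma le_dual_norm (R : realType) (X : normedModType R) (xs : dual_space X)
    (x : X) : `|xs x| <= dual_norm xs * `|x|.
Proof.
have [->|x0] := eqVneq x 0; first by rewrite linear0 !normr0 mulr0.
have nx0 : 0 < `|x| by rewrite normr_gt0.
rewrite -ler_pdivrMr//; apply: (ub_le_sup (dual_bounded xs)).
exists (`|x|^-1 *: x) => /=.
  by rewrite normrZ normfV normr_id mulVf// gt_eqF.
by rewrite linearZ /= normrM normfV normr_id mulrC.
Qed.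

(** Clearing the denominator turns the liminf into a local linear minorant of g, the form in which
    estimates can be added. The constant [c] exceeds [eps] strictly because a liminf is only
    approached; the centre [xb], excluded from the liminf, satisfies the bound trivially. *)
Lemma frechet_subdiffP (R : realType) (X : normedModType R) (eps : R)
    (g : X -> \bar R) (xb : X) (xs : dual_space X) :
  g xb \is a fin_num ->
  frechet_subdiff eps g xb xs <->
  forall c, eps < c -> exists2 d : R, 0 < d & forall x, `|x - xb| < d ->
    (g xb + (xs (x - xb) - c * `|x - xb|)%:E <= g x)%E.
Proof.
move=> gxb.
have quotE c x : x != xb ->
    ((- c)%:E <= (g x - g xb - (xs (x - xb))%:E) * (`|x - xb|^-1)%:E)%E =
    (g xb + (xs (x - xb) - c * `|x - xb|)%:E <= g x)%E.
  move=> xxb; have nx : 0 < `|x - xb| by rewrite normr_gt0 subr_eq0.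
  rewrite lee_pdivlMr// leeBrDr// leeBrDr// -EFinM -EFinD addeC.
  by rewrite [- c * _ + _]addrC mulNr.
rewrite /frechet_subdiff /= limf_einfE; split.
  move=> epsg c epsc.
  have : ((- c)%:E < ereal_sup [set ereal_inf [set
      ((g x - g xb - (xs (x - xb))%:E) * (`|x - xb|^-1)%:E)%E | x in V]
      | V in xb^'])%E by apply: lt_le_trans epsg; rewrite lte_fin ltrN2.
  move=> /ereal_sup_gt[_ [V xbV <-]] cV.
  have /nbhs_ballP[d d0 dV] := xbV.
  exists d => // x xd.
  have [->|xxb] := eqVneq x xb.
    by rewrite subrr linear0 normr0 mulr0 subr0 adde0.
  rewrite -quotE//; apply: (le_trans (ltW cV)); apply: ereal_inf_lbound.
  by exists x => //; apply: dV => //; rewrite -ball_normE /= distrC.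
(* It suffices to reach - eps - e for each e > 0; the punctured ball obtained from c = eps + e is
   one of the sets in the supremum. *)
move=> cg; apply/lee_addgt0Pr => e e0.
have [|d d0 dg] := cg (eps + e); first by rewrite ltrDl.
rewrite -leeBlDr//.
apply: (@le_trans _ _ (ereal_inf [set
    ((g x - g xb - (xs (x - xb))%:E) * (`|x - xb|^-1)%:E)%E
    | x in ball xb d `\ xb])).
  apply: le_ereal_inf_tmp => _ [x [xd /= xxb] <-].
  rewrite -EFinB -opprD quotE; last exact/eqP.
  by apply: dg; move: xd; rewrite -ball_normE /= distrC.
apply: ereal_sup_ubound; exists (ball xb d `\ xb) => //.
apply/nbhs_ballP; exists d => // x xd xxb.
by split => //; exact/eqP.
Qed.

(* For [y] with [`|y - x| <= K * `|x - xb|] the two local estimates add up; for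
   the remaining [y], coercivity and the center-Lipschitz condition already
   dominate the linear term, by the choice of [K]. *)
Lemma frechet_subdiff_inf_conv (R : realType) (X : normedModType R)
    (phi f : X -> \bar R) (xb : X) (m l eps : R) (xs : dual_space X) :
  (forall x, (-oo < phi x)%E) -> (forall x, (-oo < f x)%E) -> phi 0 = 0%E ->
  S0 phi f xb -> 0 < m -> coercive m phi -> 0 <= l -> l < m ->
  center_lipschitz l f (dom f) xb -> 0 <= eps ->
  frechet_subdiff eps f xb xs -> frechet_subdiff eps phi 0 (- xs) ->
  frechet_subdiff ((2 * (dual_norm xs + m) * (m - l)^-1 + 1) * eps)
    (inf_conv phi f) xb xs.
Proof.
move=> phiNy fNy phi0 [domT Tf] m0 phim l0 lm fl eps0.
have fxb : f xb \is a fin_num by rewrite -Tf.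
have phi0_fin : phi 0 \is a fin_num by rewrite phi0.
move=> /(frechet_subdiffP _ _ fxb) xsf.
move=> /(frechet_subdiffP _ _ phi0_fin) xsphi.
apply/(frechet_subdiffP _ _ domT) => c.
set N := dual_norm xs; have N0 : 0 <= N := dual_norm_ge0 xs.
have ml0 : 0 < m - l by rewrite subr_gt0.
(* [K] is the threshold at which (m - l)|y - x| reaches (N + m)|x - xb|; alpha is 2K + 1. *)
set K := (N + m) / (m - l).
have K0 : 0 < K by rewrite divr_gt0// ltr_wpDl.
have KE : K * (m - l) = N + m by rewrite mulfVK// gt_eqF.
have -> : 2 * (N + m) * (m - l)^-1 + 1 = 2 * K + 1 by rewrite mulrA.
clearbody K => epsc.
have a0 : 0 < 2 * K + 1 by lra.
(* For near y, |y - x| + |y - xb| <= (2K + 1)|x - xb|, so each local estimate may use the constant c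
   / (2K + 1). *)
have epse : eps < c / (2 * K + 1) by rewrite ltr_pdivlMr// mulrC.
have [d1 d10 xsf1] := xsf _ epse.
have [d2 d20 xsphi2] := xsphi _ epse.
have := divfK (lt0r_neq0 a0) c; move: epse xsf1 xsphi2.
set e := c / (2 * K + 1); clearbody e => epse xsf1 xsphi2 ec.
have K10 : 0 < K + 1 by lra.
(* Near y satisfy |y - xb| <= (K + 1)|x - xb|, hence stay inside both local radii. *)
exists (Num.min d1 d2 / (K + 1)); first by rewrite divr_gt0// lt_min d10.
move=> x; rewrite ltr_pdivlMr// lt_min => /andP[xd1 xd2].
rewrite Tf; apply: le_ereal_inf_tmp => _ [y _ <-].
have [fy|fy] := boolP (f y \is a fin_num); last first.
  have -> : f y = +oo%E by move: fy (fNy y); case: (f y).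
  by rewrite addey ?leey// gt_eqF.
have tri : `|y - xb| <= `|y - x| + `|x - xb|.
  by rewrite (le_trans _ (ler_normD _ _))// addrA subrK.
have nx0 : 0 <= `|x - xb| := normr_ge0 _.
have ny0 : 0 <= `|y - x| := normr_ge0 _.
have [yK|yK] := leP `|y - x| (K * `|x - xb|).
- have yd1 : `|y - xb| < d1 by lra.
  have yd2 : `|y - x| < d2 by lra.
  have := xsphi2 (y - x); rewrite subr0 phi0 add0e => /(_ yd2) phi_ge.
  apply: (le_trans _ (leeD phi_ge (xsf1 _ yd1))).
  have xsE : xs (y - xb) = xs (y - x) + xs (x - xb).
    by rewrite -linearD /= addrA subrK.
  have xsN : (- xs) (y - x) = - xs (y - x) by [].
  rewrite addeCA leeD2lE// -EFinD lee_fin xsE xsN -ec.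
  have : e * (`|y - x| + `|y - xb|) <= e * ((2 * K + 1) * `|x - xb|).
    by apply: ler_wpM2l; [exact: le_trans eps0 (ltW epse)|lra].
  lra.
have fy_ge : (f xb + (- (l * `|y - xb|))%:E <= f y)%E.
  rewrite EFinN leeBlDr// addeC -leeBlDr//.
  by rewrite (le_trans _ (fl _ fy))// -abseN fin_num_oppeB// addeC lee_abs.
have xs_le : xs (x - xb) <= N * `|x - xb|.
  exact: le_trans (ler_norm _) (le_dual_norm xs _).
apply: (le_trans _ (leeD (phim (y - x)) fy_ge)).
rewrite addeCA leeD2lE// -EFinD lee_fin.
(* Far case: m|y - x| - l|y - xb| >= (m - l)|y - x| - l|x - xb| >= (N + m - l)|x - xb| >= N|x - xb|,
   which dominates xs(x - xb) - c|x - xb|. *)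
have c0 : 0 <= c by nra.
have ltri : l * `|y - xb| <= l * (`|y - x| + `|x - xb|) by rewrite ler_wpM2l.
have far : (N + m) * `|x - xb| <= (m - l) * `|y - x|.
  by rewrite -KE -mulrA mulrCA ler_wpM2l// ltW// ltW.
have cx0 : 0 <= c * `|x - xb| by rewrite mulr_ge0.
have lx : l * `|x - xb| <= m * `|x - xb| by rewrite ler_wpM2r// ltW.
lra.
Qed.

(** Two choices in the infimum suffice: y = x gives T <= f, and y = xb gives T(xb - u) <= phi(u) +
    f(xb). *)
Lemma frechet_subdiff_inf_conv_sub (R : realType) (X : normedModType R)
    (phi f : X -> \bar R) (xb : X) (eps : R) (xs : dual_space X) :
  phi 0 = 0%E -> S0 phi f xb ->
  frechet_subdiff eps (inf_conv phi f) xb xs ->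
  frechet_subdiff eps f xb xs /\ frechet_subdiff eps phi 0 (- xs).
Proof.
move=> phi0 [domT Tf] /(frechet_subdiffP _ _ domT) xsT.
have fxb : f xb \is a fin_num by rewrite -Tf.
have phi0_fin : phi 0 \is a fin_num by rewrite phi0.
have T_le x y : (inf_conv phi f x <= phi (y - x)%R + f y)%E.
  by apply: ereal_inf_lbound; exists y.
split.
  apply/(frechet_subdiffP _ _ fxb) => c /xsT[d d0 dT].
  exists d => // x /dT; rewrite Tf => /le_trans; apply.
  by rewrite (le_trans (T_le x x))// subrr phi0 add0e.
apply/(frechet_subdiffP _ _ phi0_fin) => c /xsT[d d0 dT].
exists d => // u; rewrite subr0 phi0 add0e => ud.
have xbuE : xb - u - xb = - u by rewrite addrAC subrr add0r.
(* Evaluating at xb - u makes the argument of phi equal to u and flips the sign of the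
   functional. *)
have := dT (xb - u); rewrite xbuE normrN => /(_ ud).
move=> /le_trans-/(_ _ (T_le _ xb)).
by rewrite Tf subKr [leRHS]addeC leeD2lE// linearN.
Qed.

Theorem theorem2p3 (R : realType) (X : normedModType R)
    (phi f : X -> \bar R)
    (phi_gtNy : forall x, (-oo < phi x)%E)
    (f_gtNy : forall x, (-oo < f x)%E)
    (phi0 : phi 0 = 0%E)
    (xb : X) (xbS0 : S0 phi f xb)
    (m l : R) (m_gt0 : 0 < m) (phi_coercive : coercive m phi)
    (l_ge0 : 0 <= l) (l_lt_m : l < m)
    (f_lip : center_lipschitz l f (dom f) xb) :
  (forall (eps : R) (xs : dual_space X), 0 <= eps ->
     (frechet_subdiff eps f xb `&`
       [set - a | a in frechet_subdiff eps phi 0]) xs ->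
     let alpha := 2 * (dual_norm xs + m) * (m - l)^-1 + 1 in
     frechet_subdiff (alpha * eps) (inf_conv phi f) xb xs) /\
  frechet_subdiff 0 (inf_conv phi f) xb =
    frechet_subdiff 0 f xb `&` [set - a | a in frechet_subdiff 0 phi 0].
Proof.
have conv eps xs : 0 <= eps ->
    (frechet_subdiff eps f xb `&`
      [set - a | a in frechet_subdiff eps phi 0]) xs ->
    let alpha := 2 * (dual_norm xs + m) * (m - l)^-1 + 1 in
    frechet_subdiff (alpha * eps) (inf_conv phi f) xb xs.
  move=> eps0 [xsf [a aphi axs]] alpha.
  have xsphi : frechet_subdiff eps phi 0 (- xs) by rewrite -axs opprK.
  exact: frechet_subdiff_inf_conv.
split=> //; apply/seteqP; split=> xs.
  move=> /(frechet_subdiff_inf_conv_sub phi0 xbS0)[xsf xsphi].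
  by split=> //; exists (- xs) => //; rewrite opprK.
by move=> /(conv _ _ (lexx 0)); rewrite /= mulr0.
Qed.
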